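(* Let $\mathcal{M}=\langle W,R,V\rangle$ be a relational model, let $w\in W$, and let $\varphi$ be a formula of swap logic $\mathcal{ML}(\langle\mathsf{sw}\rangle,\langle\mathsf{gsw}\rangle)$. Then $$\mathcal{M},w\models\varphi\quad\text{if and only if}\quad \mathcal{M},w\models(\varphi)'_{\emptyset},$$ where $(\varphi)'_\emptyset$ is the translation of $\varphi$ into the hybrid logic $\mathcal{HL}(\mathsf{E},\downarrow)$ defined in the context (taken with parameter $S=\emptyset$), and where on the right-hand side $\mathcal{M}$ is regarded as a hybrid model by letting the nominals denote arbitrary states of $W$.
   Context: Let $\mathsf{PROP}$ be a countably infinite set of propositional symbols and $\mathsf{NOM}$ a countably infinite set of nominals; formulas of swap logic contain no nominals. **Models.** A model is $\mathcal{M}=\langle W,R,V\rangle$ with $W\neq\emptyset$, $R\subseteq W\times W$, and $V$ assigning to each $p\in\mathsf{PROP}$ a subset $V(p)\subseteq W$. A hybrid model additionally has $V$ assigning to each nominal a singleton subset of $W$. For $(v,u)\in R$, $\mathcal{M}^*_{uv}=\langle W,(R\setminus\{(v,u)\})\cup\{(u,v)\},V\rangle$. **Swap logic** $\mathcal{ML}(\langle\mathsf{sw}\rangle,\langle\mathsf{gsw}\rangle)$: formulas are $\bot\mid p\mid\neg\varphi\mid\varphi\wedge\psi\mid\Diamond\varphi\mid\langle\mathsf{sw}\rangle\varphi\mid\langle\mathsf{gsw}\rangle\varphi$ with $p\in\mathsf{PROP}$. Semantics: $\bot$, $p$ (true at $w$ iff $w\in V(p)$), $\neg$, $\wedge$ as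 usual; $\mathcal{M},w\models\Diamond\varphi$ iff $\mathcal{M},v\models\varphi$ for some $v$ with $(w,v)\in R$; $\mathcal{M},w\models\langle\mathsf{sw}\rangle\varphi$ iff for some $v$ with $(w,v)\in R$, $\mathcal{M}^*_{vw},v\models\varphi$; $\mathcal{M},w\models\langle\mathsf{gsw}\rangle\varphi$ iff for some $(v,u)\in R$, $\mathcal{M}^*_{uv},w\models\varphi$. **Hybrid logic** $\mathcal{HL}(\mathsf{E},\downarrow)$: built from propositional symbols and nominals using $\bot,\neg,\wedge,\Diamond$, $\mathsf{E}$ and $\downarrow n.$ (for $n\in\mathsf{NOM}$). Semantics: $\bot$, $p$ (true at $w$ iff $w\in V(p)$), $\neg$, $\wedge$ have their usual meaning; $\mathcal{M},w\models\Diamond\varphi$ iff $\mathcal{M},v\models\varphi$ for some $v$ with $(w,v)\in R$; a nominal $n$ is true at $w$ iff $V(n)=\{w\}$; $\mathcal{M},w\models\mathsf{E}\varphi$ iff $\mathcal{M},v\models\varphi$ for some $v\in W$; $\langle W,R,V\rangle,w\models\,\downarrow n.\varphi$ iff $\langle W,R,V_n^w\rangle,w\models\varphi$, where $V_n^w$ agrees with $V$ except that $V_n^w(n)=\{w\}$. The satisfaction operator $n{:}\varphi$ (true iff $\varphi$ is true at the state denoted by $n$) abbreviates $\mathsf{E}(n\wedge\varphi)$. **Translation.** For finite $S\subseteq\mathsf{NOM}\times\mathsf{NOM}$ (with $nm$ shorthand for $(n,m)$ or $\{(n,m)\}$, and $S^{-1}=\{(y,x)\mid(x,y)\in S\}$)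 define $$\begin{aligned} (\bot)'_S&=\bot,\quad (p)'_S=p,\quad (\neg\varphi)'_S=\neg(\varphi)'_S,\quad (\varphi\wedge\psi)'_S=(\varphi)'_S\wedge(\psi)'_S,\\ (\Diamond\varphi)'_S&=\big(\downarrow n.\Diamond(\neg\mathsf{belongs}(n,S)\wedge(\varphi)'_S)\big)\ \vee\ \mathsf{isSat}(S^{-1},(\varphi)'_S),\\ (\langle\mathsf{sw}\rangle\varphi)'_S&=\big((\downarrow n.\Diamond n)\wedge(\varphi)'_S\big)\\ &\quad\vee\ \downarrow n.\Diamond\big(\neg n\wedge\neg\mathsf{belongs}(n,S)\wedge\neg\mathsf{belongs}(n,S^{-1})\wedge\downarrow m.(\varphi)'_{S\cup nm}\big)\\ &\quad\vee\ \bigvee_{xy\in S}\big(y\wedge x{:}(\varphi)'_{(S\setminus xy)\cup yx}\big),\\ (\langle\mathsf{gsw}\rangle\varphi)'_S&=\big((\mathsf{E}\downarrow n.\Diamond n)\wedge(\varphi)'_S\big)\\ &\quad\vee\ \downarrow k.\mathsf{E}\downarrow n.\Diamond\big(\neg n\wedge\neg\mathsf{belongs}(n,S)\wedge\neg\mathsf{belongs}(n,S^{-1})\wedge\downarrow m.\,k{:}(\varphi)'_{S\cup nm}\big)\\ &\quad\vee\ \bigvee_{xy\in S}(\varphi)'_{(S\setminus xy)\cup yx}, \end{aligned}$$ where $n,m,k$ are pairwise distinct nominals not appearing in $S$, $\mathsf{belongs}(n,S)=\bigvee_{(x,y)\in S}(y\wedge n{:}x)$ and $\mathsf{isSat}(S,\psi)=\bigvee_{(x,y)\in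 S}(x\wedge y{:}\psi)$ (empty disjunctions being $\bot$). The nominals of $(\varphi)'_\emptyset$ are all bound, so its truth value does not depend on the initial denotation of the nominals. *)

(* Defs.v *)
From mathcomp Require Import all_boot finmap.
From mathcomp Require Import boolp classical_sets.

Set Implicit Arguments.
Unset Strict Implicit.
Unset Printing Implicit Defensive.

Local Open Scope classical_set_scope.

Definition countably_infinite (T : Type) : Prop :=
  exists f : nat -> T, bijective f.

Record model (PROP : Type) := Model {
  world : Type;
  world_inh : inhabited world;
  acc : set (world * world);
  valuation : PROP -> set world
}.

Arguments world {PROP} M : rename.
Arguments world_inh {PROP} M : rename.
Arguments acc {PROP} M : rename.
Arguments valuation {PROP} M p : rename.

(* The model M*_{uv}: the edge (v, u) is replaced by (u, v). *)
Definition swap_edge (PROP : Type) (M : model PROP) (u v : world M)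
  : model PROP :=
  Model (world_inh M) ((acc M `\ (v, u)) `|` [set (u, v)]) (valuation M).

Arguments swap_edge {PROP} M u v.

Inductive swform (PROP : Type) : Type :=
| SBot
| SVar of PROP
| SNot of swform PROP
| SAnd of swform PROP & swform PROP
| SDia of swform PROP
| SSw of swform PROP
| SGsw of swform PROP.

Arguments SBot {PROP}.

Fixpoint sat (PROP : Type) (M : model PROP) (w : world M) (phi : swform PROP)
  {struct phi} : Prop :=
  match phi with
  | SBot => False
  | SVar p => valuation M p w
  | SNot phi1 => ~ sat w phi1
  | SAnd phi1 phi2 => sat w phi1 /\ sat w phi2
  | SDia phi1 => exists v : world M, acc M (w, v) /\ sat v phi1
  | SSw phi1 => exists v : world M,
      acc M (w, v) /\ @sat PROP (swap_edge M v w) v phi1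
  | SGsw phi1 => exists v u : world M,
      acc M (v, u) /\ @sat PROP (swap_edge M u v) w phi1
  end.

Arguments sat {PROP} M w phi.

Record hmodel (PROP NOM : Type) := HModel {
  base :> model PROP;
  nomval : NOM -> set (world base);
  nomval_singleton : forall n, exists u, nomval n = [set u]
}.

Arguments base {PROP NOM} H : rename.
Arguments nomval {PROP NOM} H n : rename.
Arguments nomval_singleton {PROP NOM} H n : rename.

Lemma hybrid_singleton (W NOM : Type) (g : NOM -> W) (n : NOM) :
  exists u, [set g n] = [set u].
Proof. by exists (g n). Qed.

Definition hybrid (PROP NOM : Type) (M : model PROP) (g : NOM -> world M)
  : hmodel PROP NOM :=
  @HModel PROP NOM M (fun n => [set g n]) (hybrid_singleton g).

Arguments hybrid {PROP NOM} M g.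

Lemma bind_singleton (PROP : Type) (NOM : eqType) (H : hmodel PROP NOM)
    (n : NOM) (w : world H) (i : NOM) :
  exists u, (if i == n then [set w] else nomval H i) = [set u].
Proof. by case: eqP => _; [exists w | exact: nomval_singleton]. Qed.

Definition bind (PROP : Type) (NOM : eqType) (H : hmodel PROP NOM)
    (n : NOM) (w : world H) : hmodel PROP NOM :=
  @HModel PROP NOM H (fun i => if i == n then [set w] else nomval H i)
    (@bind_singleton PROP NOM H n w).

Inductive hform (PROP NOM : Type) : Type :=
| HBot
| HVar of PROP
| HNom of NOM
| HNot of hform PROP NOM
| HAnd of hform PROP NOM & hform PROP NOM
| HDia of hform PROP NOM
| HE of hform PROP NOM
| HDown of NOM & hform PROP NOM.

Arguments HBot {PROP NOM}.
Arguments HVar {PROP NOM}.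
Arguments HNom {PROP NOM}.

Fixpoint hsat (PROP : Type) (NOM : eqType) (H : hmodel PROP NOM)
    (w : world H) (phi : hform PROP NOM) {struct phi} : Prop :=
  match phi with
  | HBot => False
  | HVar p => valuation H p w
  | HNom n => nomval H n = [set w]
  | HNot phi1 => ~ hsat w phi1
  | HAnd phi1 phi2 => hsat w phi1 /\ hsat w phi2
  | HDia phi1 => exists v : world H, acc H (w, v) /\ hsat v phi1
  | HE phi1 => exists v : world H, hsat v phi1
  | HDown n phi1 => @hsat PROP NOM (bind n w) w phi1
  end.

Arguments hsat {PROP NOM} H w phi.

Section Translation.

Variables (PROP : Type) (NOM : choiceType).
Implicit Types (S : {fset NOM * NOM}) (psi : hform PROP NOM).

Definition HOr (psi1 psi2 : hform PROP NOM) : hform PROP NOM :=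
  HNot (HAnd (HNot psi1) (HNot psi2)).

Definition HAt (n : NOM) psi : hform PROP NOM := HE (HAnd (HNom n) psi).

(* An empty disjunction is HBot. *)
Definition HBigOr S (F : NOM * NOM -> hform PROP NOM) : hform PROP NOM :=
  \big[HOr/HBot]_(xy <- enum_fset S) F xy.

Definition invS S : {fset NOM * NOM} := [fset (xy.2, xy.1) | xy in S]%fset.

Definition belongs (n : NOM) S : hform PROP NOM :=
  HBigOr S (fun xy => HAnd (HNom xy.2) (HAt n (HNom xy.1))).

Definition isSat S psi : hform PROP NOM :=
  HBigOr S (fun xy => HAnd (HNom xy.1) (HAt xy.2 psi)).

Definition appears (n : NOM) S : Prop :=
  exists2 xy, xy \in S & n = xy.1 \/ n = xy.2.

(* A choice of the bound nominals n, m, k used at each step (phi)'_S of the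
   translation. *)
Definition nominal_choice : Type :=
  {fset NOM * NOM} -> swform PROP -> NOM * NOM * NOM.

Definition fresh_choice (pick : nominal_choice) : Prop :=
  forall S phi, let: (n, m, k) := pick S phi in
    [/\ n != m, n != k & m != k] /\
    [/\ ~ appears n S, ~ appears m S & ~ appears k S].

(* (S \ xy) \cup yx *)
Definition flip S (xy : NOM * NOM) : {fset NOM * NOM} :=
  ((xy.2, xy.1) |` (S `\ xy))%fset.

Fixpoint trans (pick : nominal_choice) S (phi : swform PROP) {struct phi}
  : hform PROP NOM :=
  match phi with
  | SBot => HBot
  | SVar p => HVar p
  | SNot phi1 => HNot (trans pick S phi1)
  | SAnd phi1 phi2 => HAnd (trans pick S phi1) (trans pick S phi2)
  | SDia phi1 =>
      let: (n, _, _) := pick S phi in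
      HOr (HDown n (HDia (HAnd (HNot (belongs n S)) (trans pick S phi1))))
          (isSat (invS S) (trans pick S phi1))
  | SSw phi1 =>
      let: (n, m, _) := pick S phi in
      HOr (HOr
        (HAnd (HDown n (HDia (HNom n))) (trans pick S phi1))
        (HDown n (HDia
          (HAnd (HAnd (HAnd
            (HNot (HNom n))
            (HNot (belongs n S)))
            (HNot (belongs n (invS S))))
            (HDown m (trans pick ((n, m) |` S)%fset phi1))))))
        (HBigOr S (fun xy =>
          HAnd (HNom xy.2) (HAt xy.1 (trans pick (flip S xy) phi1))))
  | SGsw phi1 =>
      let: (n, m, k) := pick S phi in
      HOr (HOr
        (HAnd (HE (HDown n (HDia (HNom n)))) (trans pick S phi1))
        (HDown k (HE (HDown n (HDia
          (HAnd (HAnd (HAnd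
            (HNot (HNom n))
            (HNot (belongs n S)))
            (HNot (belongs n (invS S))))
            (HDown m (HAt k (trans pick ((n, m) |` S)%fset phi1)))))))))
        (HBigOr S (fun xy => trans pick (flip S xy) phi1))
  end.

End Translation.

(* Main.v *)
Require Import Defs.
From mathcomp Require Import all_boot finmap.
From mathcomp Require Import boolp classical_sets.

(** Along an evaluation of [trans], the model reached by swapping is recovered
  from the original relation [R] and the finite set [S] by reversing the edges
  of [S]: the current relation is [R] minus the edges denoted by [S], plus their
  converses. This is sound because distinct pairs of [S] denote edges that
  differ even up to orientation: a new pair is recorded only if neither the edge
  nor its converse is in [S], and an edge of [S] traversed backwards is merely
  flipped. Loops are unchanged by swapping and are never recorded. *)

Set Implicit Arguments.
Unset Strict Implicit.
Unset Printing Implicit Defensive.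

Local Open Scope classical_set_scope.

(** * Reversing a set of edges in a relation *)

Section Reorient.

Variable W : Type.
Implicit Types (R E : set (W * W)) (u v : W).

Definition swap_rel R u v : set (W * W) := (R `\ (v, u)) `|` [set (u, v)].

Definition reorient R E : set (W * W) :=
  [set e | R e /\ ~ E e \/ E (e.2, e.1)].

Definition oriented E : Prop := forall u v, E (u, v) -> ~ E (v, u).

Lemma reorient0 R : reorient R set0 = R.
Proof.
by apply/seteqP; split=> [e [[]|] //|e Re]; left; split.
Qed.

Lemma oriented_irrefl E u : oriented E -> ~ E (u, u).
Proof. by move=> oE Euu; exact: (oE u u). Qed.

Lemma reorient_loop R E u : oriented E -> reorient R E (u, u) <-> R (u, u).
Proof.
move=> oE; have nE := @oriented_irrefl E u oE.
by split=> [[[]//|/nE]//|Ruu]; left.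
Qed.

(** The extra [~ E (v, u)] makes the cases exclusive and matches the guards of the translated swap
    operators: a new edge, or a recorded one seen backwards. *)
Lemma reorientP R E u v : reorient R E (u, v) <->
  [/\ R (u, v), ~ E (u, v) & ~ E (v, u)] \/ E (v, u).
Proof.
split=> [|[[Ruv nE _]|Evu]]; [|by left|by right].
case: (pselect (E (v, u))) => [|nE]; first by right.
by case=> [[Ruv nE']|//]; left.
Qed.

Lemma swap_rel_loop R u : R (u, u) -> swap_rel R u u = R.
Proof.
move=> Ruu; apply/seteqP; split=> [e [[]//|->//]|e Re].
by case: (pselect (e = (u, u))) => [->|ne]; [right | left].
Qed.

(** Were [(v, u)] already in [E], the right side would keep [(u, v)] as its converse. *)
Lemma swap_rel_reorient_add R E u v : u <> v -> ~ E (u, v) -> ~ E (v, u) ->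
  swap_rel (reorient R E) v u = reorient R ((u, v) |` E).
Proof.
move=> uv nEuv nEvu; apply/seteqP; split=> [[a b]|[a b]] /=.
- move=> [[[[Rab nE]|Eba] nab]|[-> ->]]; last by right; left.
  + by left; split=> // -[].
  + by right; right.
- move=> [[Rab nE]|[[-> ->]|Eba]]; last 2 first.
  + by right.
  + by left; split; [right | case=> ? ?; subst].
  + left; split; first by left; split=> // Eab; apply: nE; right.
    by move=> ab; apply: nE; left.
Qed.

(** The pair is flipped rather than deleted: if [R] contains both directions, deletion would restore
    both, whereas swapping back leaves only [(u, v)]. *)
Lemma swap_rel_reorient_flip R E u v : oriented E -> E (u, v) ->
  swap_rel (reorient R E) u v = reorient R ((v, u) |` (E `\ (u, v))).
Proof.
move=> oE Euv; have nEvu := oE _ _ Euv.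
apply/seteqP; split=> [[a b]|[a b]] /=.
- move=> [[[[Rab nE]|Eba] nab]|[-> ->]]; last by right; left.
  + by left; split=> // -[//|[]].
  + by right; right; split=> // -[? ?]; subst; apply: nab.
- move=> [[Rab nE]|[[-> ->]|[Eba nba]]]; last 2 first.
  + by right.
  + by left; split; [right | case=> ? ?; subst; apply: nba].
  + case: (pselect ((a, b) = (u, v))) => [->|nuv]; first by right.
    left; split; last by move=> ab; apply: nE; left.
    by left; split=> // Eab; apply: nE; right.
Qed.

End Reorient.

(** * Edges denoted by a set of pairs of nominals *)

Section Denotation.

Variables (NOM : choiceType) (W : Type).
Implicit Types (g : NOM -> W) (S : {fset NOM * NOM}).

Definition upd g (n : NOM) (u : W) : NOM -> W :=
  fun i => if i == n then u else g i.

Definition edges g S : set (W * W) :=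
  [set e | exists2 xy, xy \in S & e = (g xy.1, g xy.2)].

(** Injectivity is asked of edges, not of nominals, since distinct nominals may name the same
    state. *)
Definition faithful g S : Prop :=
  oriented (edges g S) /\
  {in S &, injective (fun xy => (g xy.1, g xy.2))}.

Lemma updE g n u : upd g n u n = u.
Proof. by rewrite /upd eqxx. Qed.

Lemma updNE g n u i : i != n -> upd g n u i = g i.
Proof. by rewrite /upd => /negbTE->. Qed.

Lemma upd_fresh g S n u xy : ~ appears n S -> xy \in S ->
  (upd g n u xy.1, upd g n u xy.2) = (g xy.1, g xy.2).
Proof.
move=> nS xyS; rewrite !updNE //; apply/eqP => xyn; apply: nS;
  by exists xy => //; auto.
Qed.

Lemma edges_upd g S n u : ~ appears n S -> edges (upd g n u) S = edges g S.
Proof.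
by move=> nS; apply/seteqP; split=> e [xy xyS ->]; exists xy => //;
  rewrite (upd_fresh _ _ nS).
Qed.

Lemma faithful_upd g S n u : ~ appears n S ->
  faithful g S -> faithful (upd g n u) S.
Proof.
move=> nS [oS injS]; split; first by rewrite edges_upd.
by move=> p q pS qS /=; rewrite !(upd_fresh _ _ nS) //; apply: injS.
Qed.

Lemma edges0 g : edges g fset0 = set0.
Proof. by apply/seteqP; split=> // e [xy]; rewrite inE. Qed.

Lemma faithful0 g : faithful g fset0.
Proof. by split=> [u v|p q]; rewrite ?edges0 // inE. Qed.

Lemma edges_add g S n m :
  edges g ((n, m) |` S)%fset = (g n, g m) |` edges g S.
Proof.
apply/seteqP; split=> [e [xy /fset1UP[->|xyS] ->]|e [->|[xy xyS ->]]].
- by left.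
- by right; exists xy.
- by exists (n, m) => //; exact: fset1U1.
- by exists xy => //; exact: fset1Ur.
Qed.

Lemma faithful_add g S n m : faithful g S -> g n <> g m ->
  ~ edges g S (g n, g m) -> ~ edges g S (g m, g n) ->
  faithful g ((n, m) |` S)%fset.
Proof.
move=> [oS injS] nm nE nE'; split.
- rewrite edges_add => u v [[-> ->]|Euv] [[]|] //; last exact: oS.
  by move=> ? ?; subst; apply: nE'.
- move=> p q /fset1UP[->|pS] /fset1UP[->|qS] //= pq.
  + by case: nE; exists q.
  + by case: nE; exists p.
  + exact: injS.
Qed.

(** By injectivity no second pair of [S] keeps the edge alive once [xy] is removed. *)
Lemma edges_flip g S xy : faithful g S -> xy \in S ->
  edges g (flip S xy) =
  (g xy.2, g xy.1) |` (edges g S `\ (g xy.1, g xy.2)).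
Proof.
move=> [oS injS] xyS; rewrite /flip edges_add; congr (_ `|` _).
apply/seteqP; split=> [e [p /fsetD1P[/eqP pxy pS] ->]|e [[p pS ->] npxy]].
- by split; [exists p | move=> /injS H; apply: pxy; exact: H].
- exists p => //; apply/fsetD1P; split=> //.
  by apply/eqP => pxy; apply: npxy; rewrite pxy.
Qed.

(** Seen as adding the converse pair to [S] without [xy]: orientation excludes a loop and a copy of
    the converse edge, injectivity a second copy of the edge itself. *)
Lemma faithful_flip g S xy : faithful g S -> xy \in S ->
  faithful g (flip S xy).
Proof.
move=> fS xyS; have [oS injS] := fS.
have E : edges g S (g xy.1, g xy.2) by exists xy.
have sub : edges g (S `\ xy)%fset `<=` edges g S.
  by move=> e [p /fsetD1P[_ pS] ->]; exists p.
apply: faithful_add.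
- split; first by move=> u v /sub Euv /sub; exact: oS.
  by move=> p q /fsetD1P[_ pS] /fsetD1P[_ qS]; exact: injS.
- by move=> yx; rewrite yx in E; exact: (oS _ _ E E).
- by move=> /sub; exact: oS.
- move=> [p /fsetD1P[/eqP pxy pS] e]; apply: pxy.
  by apply: injS => //; rewrite e.
Qed.

(** Serves both swap operators. By freshness, binding [n] and [m] does not disturb the edges of [S],
    so only the new pair needs checking. *)
Lemma faithful_new_edge R g S n m u v : n != m ->
  ~ appears n S -> ~ appears m S -> faithful g S ->
  u <> v -> ~ edges g S (u, v) -> ~ edges g S (v, u) ->
  let h := upd (upd g n u) m v in
  faithful h ((n, m) |` S)%fset /\
  swap_rel (reorient R (edges g S)) v u =
  reorient R (edges h ((n, m) |` S)%fset).
Proof.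
move=> nm nS mS fS uv nE nE' h; have hm : h m = v by rewrite /h updE.
have hn : h n = u by rewrite /h updNE // updE.
have hS : edges h S = edges g S by rewrite /h !edges_upd.
split; last by rewrite edges_add hn hm hS swap_rel_reorient_add.
by apply: faithful_add; rewrite ?hn ?hm ?hS //; do 2!apply: faithful_upd => //.
Qed.

Lemma swap_rel_flip R g S xy : faithful g S -> xy \in S ->
  swap_rel (reorient R (edges g S)) (g xy.1) (g xy.2) =
  reorient R (edges g (flip S xy)).
Proof.
move=> fS xyS; rewrite edges_flip // swap_rel_reorient_flip //.
- exact: fS.1.
- by exists xy.
Qed.

End Denotation.

(** * Truth conditions of the formulas used by the translation *)

Section HybridSemantics.

Variables (PROP : Type) (NOM : choiceType) (M : model PROP).
Implicit Types (g : NOM -> world M) (w : world M) (S : {fset NOM * NOM}).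
Implicit Types (psi : hform PROP NOM).

Lemma hsat_or (H : hmodel PROP NOM) (w : world H) psi1 psi2 :
  hsat H w (HOr psi1 psi2) <-> hsat H w psi1 \/ hsat H w psi2.
Proof.
split=> /= [|[] ? []] //.
by move=> /not_andP[] /contrapT; [left | right].
Qed.

(** This and the next three hold by computation; they allow unfolding a single connective while
    derived operators stay folded. *)
Lemma hsat_not (H : hmodel PROP NOM) (w : world H) psi :
  hsat H w (HNot psi) <-> ~ hsat H w psi.
Proof. by []. Qed.

Lemma hsat_and (H : hmodel PROP NOM) (w : world H) psi1 psi2 :
  hsat H w (HAnd psi1 psi2) <-> hsat H w psi1 /\ hsat H w psi2.
Proof. by []. Qed.

Lemma hsat_dia (H : hmodel PROP NOM) (w : world H) psi :
  hsat H w (HDia psi) <-> exists v, acc H (w, v) /\ hsat H v psi.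
Proof. by []. Qed.

Lemma hsat_ex (H : hmodel PROP NOM) (w : world H) psi :
  hsat H w (HE psi) <-> exists v, hsat H v psi.
Proof. by []. Qed.

Lemma hsat_bigor (H : hmodel PROP NOM) (w : world H) S F :
  hsat H w (HBigOr S F) <-> exists2 xy, xy \in S & hsat H w (F xy).
Proof.
rewrite /HBigOr.
(* Membership is restated for the underlying list, so that the claim generalises to any list. *)
have -> : (exists2 xy, xy \in S & hsat H w (F xy)) =
          (exists2 xy, xy \in enum_fset S & hsat H w (F xy)) by [].
elim: (enum_fset S) => [|p s IH]; first by rewrite big_nil; split=> // -[].
rewrite big_cons hsat_or IH; split.
- case=> [Fp|[q qs Fq]]; first by exists p; rewrite ?mem_head.
  by exists q; rewrite // inE qs orbT.
- move=> [q]; rewrite inE => /orP[/eqP->|qs] Fq; first by left.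
  by right; exists q.
Qed.

Lemma hsat_nom g w n : hsat (hybrid M g) w (HNom n) <-> w = g n.
Proof.
split=> /= [E|->//].
by have : [set w] w by []; rewrite -E.
Qed.

Lemma hsat_at g w n psi :
  hsat (hybrid M g) w (HAt n psi) <-> hsat (hybrid M g) (g n) psi.
Proof.
split=> [[v [/hsat_nom-> //]]|sat_n].
by exists (g n); split=> //; apply/hsat_nom.
Qed.

(** The two hybrid models differ only in how the singletons are written and in the proof component;
    extensionality and proof irrelevance identify them. *)
Lemma hsat_bind g n u w psi :
  hsat (bind (H := hybrid M g) n u) w psi <->
  hsat (hybrid M (upd g n u)) w psi.
Proof.
have irr nv nv' p p' : nv = nv' ->
    hsat (@HModel _ _ M nv p) w psi = hsat (@HModel _ _ M nv' p') w psi.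
  by move=> e; subst nv'; rewrite (Prop_irrelevance p p').
rewrite (irr _ _ _ (hybrid_singleton (upd g n u))) //.
by apply/funext => i /=; rewrite /upd; case: ifP.
Qed.

Lemma hsat_down g n w psi : hsat (hybrid M g) w (HDown n psi) <->
  hsat (hybrid M (upd g n w)) w psi.
Proof. exact: hsat_bind. Qed.

Lemma hsat_belongs g n w S :
  hsat (hybrid M g) w (belongs PROP n S) <-> edges g S (g n, w).
Proof.
rewrite /belongs hsat_bigor; split.
- by move=> [xy xyS /hsat_and[/hsat_nom-> /hsat_at/hsat_nom->]]; exists xy.
- move=> [xy xyS [gn ->]]; exists xy => //; split; first exact/hsat_nom.
  by apply/hsat_at/hsat_nom.
Qed.

Lemma edges_inv g S u v : edges g (invS S) (u, v) <-> edges g S (v, u).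
Proof.
split=> [[_ /imfsetP[xy xyS ->] [-> ->]]|[xy xyS [-> ->]]]; first by exists xy.
by exists (xy.2, xy.1) => //; apply/imfsetP; exists xy.
Qed.

Lemma hsat_isSat g w S psi :
  hsat (hybrid M g) w (isSat S psi) <->
  exists2 v, edges g S (w, v) & hsat (hybrid M g) v psi.
Proof.
rewrite /isSat hsat_bigor; split.
- move=> [xy xyS /hsat_and[/hsat_nom-> /hsat_at sat_y]]; exists (g xy.2) => //.
  by exists xy.
- move=> [v [xy xyS [-> ->]] sat_y]; exists xy => //.
  by split; [apply/hsat_nom | apply/hsat_at].
Qed.

Lemma hsat_loop g n w :
  hsat (hybrid M g) w (HDown n (HDia (HNom n))) <-> acc M (w, w).
Proof.
rewrite hsat_down hsat_dia; split.
- by move=> [v [Rwv /hsat_nom e]]; move: Rwv; rewrite e updE.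
- by move=> Rww; exists w; split=> //; apply/hsat_nom; rewrite updE.
Qed.

(** [psi] is arbitrary so that the local swap can put a translation there and the global swap a
    translation under [HAt k]. *)
Lemma hsat_new_edge g w n m S psi : n != m -> ~ appears n S ->
  hsat (hybrid M g) w (HDown n (HDia
    (HAnd (HAnd (HAnd (HNot (HNom n)) (HNot (belongs PROP n S)))
                (HNot (belongs PROP n (invS S))))
          (HDown m psi)))) <->
  exists v, [/\ acc M (w, v), w <> v, ~ edges g S (w, v), ~ edges g S (v, w) &
    hsat (hybrid M (upd (upd g n w) m v)) v psi].
Proof.
move=> nm nS; rewrite hsat_down; split.
- move=> /hsat_dia[v [Rwv /hsat_and[/hsat_and[/hsat_and]]]].
  move=> [/hsat_not nn /hsat_not nb] /hsat_not nb' sat_v.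
  exists v; split=> //.
  + by move=> wv; apply: nn; apply/hsat_nom; rewrite updE.
  + by move=> E; apply: nb; apply/hsat_belongs; rewrite updE edges_upd.
  + move=> E; apply: nb'; apply/hsat_belongs/edges_inv.
    by rewrite updE edges_upd.
  + exact/hsat_down.
- move=> [v [Rwv wv nE nE' sat_v]]; exists v; split=> //.
  split; last exact/hsat_down.
  split; first split.
  + by move=> /hsat_nom; rewrite updE => vw; apply: wv.
  + by move=> /hsat_belongs; rewrite updE edges_upd.
  + by move=> /hsat_belongs/edges_inv; rewrite updE edges_upd.
Qed.

End HybridSemantics.

(** * Correctness of the translation for arbitrary [S] *)

Section Correctness.

Variables (PROP : Type) (NOM : choiceType) (pick : nominal_choice PROP NOM).
Hypothesis pick_fresh : fresh_choice pick.
Variable M : model PROP.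

(** Swaps preserve states and valuation, so every model reached has this shape over one fixed type
    of states. *)
Let relmodel (R : set (world M * world M)) : model PROP :=
  Model (world_inh M) R (valuation M).

Let cur (g : NOM -> world M) S := reorient (acc M) (edges g S).

Lemma swap_cur g S u v w phi :
  sat (@swap_edge PROP (relmodel (cur g S)) u v) w phi =
  sat (relmodel (swap_rel (cur g S) u v)) w phi.
Proof. by []. Qed.

Lemma trans_correct phi S (g : NOM -> world M) (w : world M) : faithful g S ->
  sat (relmodel (cur g S)) w phi <-> hsat (hybrid M g) w (trans pick S phi).
Proof.
elim: phi S g w => [|p|phi IH|phi IH1 psi IH2|phi IH|phi IH|phi IH] S g w fS //.
- by rewrite /= IH.
- by rewrite /= IH1 // IH2.
- have /= := pick_fresh S (SDia phi).
  case: (pick S (SDia phi)) => [[n m] k] [_ [nS _ _]].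
  rewrite hsat_or hsat_down hsat_dia hsat_isSat; split.
  (* An edge left in place goes to the guarded diamond, a reversed one to [isSat]. *)
  + move=> [v [Rwv sat_v]]; case: Rwv => /= [[Rwv nE]|E].
    * left; exists v; split=> //; split.
        by move=> /hsat_belongs; rewrite updE edges_upd.
      (* Binding the fresh [n] changes the valuation but not the current relation. *)
      apply/(IH S (upd g n w)); first exact: faithful_upd.
      by rewrite /cur edges_upd.
    * by right; exists v; [apply/edges_inv | apply/(IH S g)].
  + move=> [[v [Rwv /hsat_and[/hsat_not nb sat_v]]]|[v /edges_inv E sat_v]].
    * exists v; split.
        left; split=> // E; apply: nb; apply/hsat_belongs.
        by rewrite updE edges_upd.
      have := (IH S (upd g n w) v (faithful_upd w nS fS)).2 sat_v.
      by rewrite /cur edges_upd.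
    * by exists v; split; [right | apply/(IH S g)].
- have /= := pick_fresh S (SSw phi).
  case: (pick S (SSw phi)) => [[n m] k] [[nm _ _] [nS mS _]].
  rewrite !hsat_or hsat_and hsat_bigor hsat_new_edge //; split.
  + move=> [v [Rwv]]; rewrite swap_cur => sat_v.
    (* Swapping a loop changes nothing, so it is handled without recording a pair. *)
    case: (pselect (w = v)) => [wv|wv].
      subst v; left; left; split.
        by apply/hsat_loop/(reorient_loop _ _ fS.1).
      by apply/(IH S g) => //; rewrite -(swap_rel_loop Rwv).
    move/reorientP: Rwv => [[Rwv nE nE']|[xy xyS [vE wE]]].
      have [fh eh] := faithful_new_edge (acc M) nm nS mS fS wv nE nE'.
      by left; right; exists v; split=> //; apply/IH; rewrite // /cur -eh.
    subst w v; right; exists xy => //; split; first exact/hsat_nom.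
    apply/hsat_at/IH; first exact: faithful_flip.
    by rewrite /cur -swap_rel_flip.
  + move=> [[[/hsat_loop Rww sat_w]|[v [Rwv wv nE nE' sat_v]]]|].
    * have cww : cur g S (w, w) by apply/(reorient_loop _ _ fS.1).
      exists w; split=> //; rewrite swap_cur.
      by rewrite swap_rel_loop //; apply/(IH S g).
    * have [fh eh] := faithful_new_edge (acc M) nm nS mS fS wv nE nE'.
      exists v; split; first by apply/reorientP; left.
      by rewrite swap_cur /cur eh; apply/IH.
    * move=> [xy xyS /hsat_and[/hsat_nom-> /hsat_at sat_x]].
      (* A recorded [xy] currently runs from [g xy.2] to [g xy.1], so the latter is a successor of
         the evaluation state. *)
      exists (g xy.1); split; first by right; exists xy.
      by rewrite swap_cur /cur swap_rel_flip //; apply/IH => //;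
        exact: faithful_flip.
- have /= := pick_fresh S (SGsw phi).
  case: (pick S (SGsw phi)) => [[n m] k] [[nm nk mk] [nS mS kS]].
  rewrite !hsat_or hsat_and hsat_bigor hsat_down !hsat_ex.
  have fk := faithful_upd w kS fS; have Ek := edges_upd g w kS.
  (* [k] remembers the evaluation state while [n] and [m] name the ends of an edge elsewhere. *)
  have hk u v : upd (upd (upd g k w) n u) m v k = w.
    by rewrite updNE 1?eq_sym // updNE 1?eq_sym // updE.
  split.
  + move=> [u [v [Ruv]]]; rewrite swap_cur => sat_w.
    case: (pselect (u = v)) => [uv|uv].
      subst v; left; left; split.
        by exists u; apply/hsat_loop/(reorient_loop _ _ fS.1).
      by apply/(IH S g) => //; rewrite -(swap_rel_loop Ruv).
    move/reorientP: Ruv => [[Ruv nE nE']|[xy xyS [vE uE]]].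
      (* The new edge is recorded over the valuation where [k] is already bound. *)
      rewrite -Ek in nE nE'.
      have [fh eh] := faithful_new_edge (acc M) nm nS mS fk uv nE nE'.
      left; right; exists u; apply/hsat_new_edge => //; exists v; split=> //.
      by apply/hsat_at; rewrite hk; apply/IH; rewrite // /cur -eh Ek.
    subst u v; right; exists xy => //.
    apply/IH; first exact: faithful_flip.
    by rewrite /cur -swap_rel_flip.
  + move=> [[[[u /hsat_loop Ruu] sat_w]|[u /hsat_new_edge]]|].
    * have cuu : cur g S (u, u) by apply/(reorient_loop _ _ fS.1).
      exists u, u; split=> //; rewrite swap_cur.
      by rewrite swap_rel_loop //; apply/(IH S g).
    * move=> /(_ nm nS) [v [Ruv uv nE nE' /hsat_at]]; rewrite hk => sat_w.
      have [fh eh] := faithful_new_edge (acc M) nm nS mS fk uv nE nE'.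
      rewrite Ek in nE nE' eh.
      exists u, v; split; first by apply/reorientP; left.
      by rewrite swap_cur /cur eh; apply/IH.
    * move=> [xy xyS sat_w].
      exists (g xy.2), (g xy.1); split; first by right; exists xy.
      by rewrite swap_cur /cur swap_rel_flip //; apply/IH => //;
        exact: faithful_flip.
Qed.

End Correctness.

Theorem theorem3 (PROP : Type) (NOM : choiceType)
  (PROP_inf : countably_infinite PROP) (NOM_inf : countably_infinite NOM)
  (pick : nominal_choice PROP NOM) (pick_fresh : fresh_choice pick)
  (M : model PROP) (w : world M) (phi : swform PROP) (g : NOM -> world M) :
  sat M w phi <->
  hsat (hybrid M g) w (trans pick fset0 phi).
Proof.
have := trans_correct pick_fresh phi w (faithful0 g).
rewrite edges0 reorient0.
(* Destructing [M] identifies it with the model rebuilt from its own fields. *)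
by case: M w g.
Qed.
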